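(* Let $A$ be a gendo-Frobenius algebra, and let $\Delta: A\rightarrow A\otimes_k A$ be the map constructed in the context (from any choice of the data $e,\sigma,\tau$ there). Then $\Delta$ is a coassociative comultiplication, i.e. $(1\otimes\Delta)\Delta=(\Delta\otimes1)\Delta$, which is an $A$-bimodule morphism.
   Context: $k$ is an arbitrary field; all algebras and modules are finite dimensional over $k$. $\mathrm{D}=\mathrm{Hom}_k(-,k)$; $\mathrm{D}(A)$ is an $A$-bimodule via $(afb)(x)=f(bxa)$. For an automorphism $\omega$ of an algebra and a right module $N$ over it, $N_\omega$ is the vector space $N$ with right action $n\cdot a=n\,\omega(a)$ (left action, if any, unchanged). A finite dimensional $k$-algebra $B$ is Frobenius if $B\cong \mathrm{D}(B)$ as left (equivalently right) $B$-modules. A Nakayama automorphism $\nu_B$ of a Frobenius algebra $B$ is an automorphism with $B_{\nu_B}\cong \mathrm{D}(B)$ as $B$-bimodules. A finite dimensional $k$-algebra $A$ is called gendo-Frobenius if it satisfies one of the following equivalent conditions (the equivalence is a theorem of Kerner and Yamagata): (i) $A$ is isomorphic to $\mathrm{End}_B(M)$ for a finite dimensional faithful right module $M$ over a Frobenius algebra $B$ such that $M\cong M_{\nu_B}$ as right $B$-modules; (ii) $\mathrm{Hom}_A(\mathrm{D}(A),A)\cong A$ as left $A$-modules, where $\mathrm{Hom}_A$ denotes homomorphisms of left $A$-modules and the left $A$-action is $(af)(x)=f(xa)$. Construction of $\Delta$. An idempotent $e$ of $A$ is self-dual if $\mathrm{D}(eA)\cong Ae$ as left $A$-modules, and faithful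 if both $Ae$ and $eA$ are faithful $A$-modules. A gendo-Frobenius algebra $A$ has a faithful and self-dual idempotent $e$; then there are $\sigma\in\mathrm{Aut}(A)$ and an isomorphism $\tau:eA_\sigma\to \mathrm{D}(Ae)$ of $(eAe,A)$-bimodules (the bimodule structure on $\mathrm{D}(Ae)$ being $(cfa)(y)=f(ayc)$). Fix such $e,\sigma,\tau$. There is an $A$-bimodule isomorphism $\gamma: Ae\otimes_{eAe}eA_\sigma\to \mathrm{D}(A)$, $\gamma(ae\otimes eb)(x)=\tau(eb\,\sigma(x))(ae)$ for $a,b,x\in A$. Let $m:\mathrm{D}(A)\otimes_k\mathrm{D}(A)\to\mathrm{D}(A)$ be the $A$-bimodule morphism given by $m(\gamma(ae\otimes eb)\otimes_k\gamma(ce\otimes ed))=\gamma(aebce\otimes ed)$ for $a,b,c,d\in A$. Then $\Delta:A\to A\otimes_kA$ is the $k$-linear map dual to $m$, determined by $(f\otimes g)\Delta(x)=m(g\otimes f)(x)$ for all $f,g\in\mathrm{D}(A)$, $x\in A$, where $(f\otimes g)(u\otimes v)=f(u)g(v)$. $A\otimes_kA$ is an $A$-bimodule via $x(u\otimes v)y=xu\otimes vy$. *)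

(* Defs.v *)
From HB Require Import structures.
From mathcomp Require Import all_boot all_algebra all_field.

Set Implicit Arguments.
Unset Strict Implicit.
Unset Printing Implicit Defensive.

Import GRing.Theory.
Local Open Scope ring_scope.

(* The linear map U -> V induced by g on subspaces U, V of an ambient space;  *)
(* it is meaningful when g maps U into V (lemma restrE).                      *)
Definition restr {k : fieldType} {E : vectType k} (U V : {vspace E})
    (g : 'End(E)) : 'Hom(subvs_of U, subvs_of V) :=
  (linfun (@vsproj k E V) \o g \o linfun vsval)%VF.

Lemma restrE {k : fieldType} {E : vectType k} (U V : {vspace E}) (g : 'End(E))
    (u : subvs_of U) : g (vsval u) \in V -> vsval (restr U V g u) = g (vsval u).
Proof. by move=> gV; rewrite /restr !lfunE /= !lfunE /= lfunE /= vsprojK. Qed.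

Lemma restr_proj {k : fieldType} {E : vectType k} (U V : {vspace E})
    (g : 'End(E)) (u : subvs_of U) : restr U V g u = vsproj V (g (vsval u)).
Proof. by rewrite /restr !lfunE /= !lfunE /= lfunE. Qed.

(* The tensor product over k, modelled by matrices of coordinates; the        *)
(* universal property is tlift_tens together with tensor_ext.                 *)
Definition tensor {k : fieldType} (U V : vectType k) : vectType k :=
  'M[k]_(\dim {:U}, \dim {:V}).

Definition tens {k : fieldType} {U V : vectType k} (u : U) (v : V) :
    tensor U V :=
  \matrix_(i, j) (coord (vbasis {:U}) i u * coord (vbasis {:V}) j v).

Definition tlift {k : fieldType} {U V W : vectType k} (b : U -> V -> W) :
    'Hom(tensor U V, W) :=
  linfun (fun t : tensor U V =>
    \sum_i \sum_j (t : 'M[k]_(_, _)) i j *: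
      b (vbasis {:U})`_i (vbasis {:V})`_j).

Definition bilin {k : fieldType} {U V W : vectType k} (b : U -> V -> W) : Prop :=
  (forall v, linear (b^~ v)) /\ (forall u, linear (b u)).

Fact tlift_linear {k : fieldType} {U V W : vectType k} (b : U -> V -> W) :
  linear (fun t : tensor U V =>
    \sum_i \sum_j (t : 'M[k]_(_, _)) i j *:
      b (vbasis {:U})`_i (vbasis {:V})`_j).
Proof.
move=> a s t; rewrite scaler_sumr -big_split; apply: eq_bigr => i _ /=.
rewrite scaler_sumr -big_split; apply: eq_bigr => j _ /=.
by rewrite !mxE scalerDl scalerA.
Qed.

Lemma linfunE {k : fieldType} {U V : vectType k} (f : U -> V) :
  linear f -> linfun f =1 f.
Proof.
move=> fL; pose F := GRing.isSemilinear.Build k U V _ f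
  (GRing.semilinear_linear fL).
pose g : {linear U -> V} := HB.pack f F.
exact: (lfunE g).
Qed.

Lemma tens_bilin {k : fieldType} {U V : vectType k} :
  bilin (@tens k U V).
Proof.
split=> w a x y; apply/matrixP=> i j; rewrite !mxE linearP /=.
  by rewrite mulrDl mulrA.
by rewrite mulrDr mulrCA.
Qed.

Lemma linear_suml {k : fieldType} {U V : vectType k} (f : U -> V) (I : finType)
    (c : I -> k) (x : I -> U) :
  linear f -> f (\sum_i c i *: x i) = \sum_i c i *: f (x i).
Proof.
move=> fL; rewrite -(linfunE fL) linear_sum; apply: eq_bigr => i _.
by rewrite linearZ /= linfunE.
Qed.

Lemma tliftE {k : fieldType} {U V W : vectType k} (b : U -> V -> W)
    (t : tensor U V) :
  tlift b t = \sum_i \sum_j (t : 'M[k]_(_, _)) i j *: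
    b (vbasis {:U})`_i (vbasis {:V})`_j.
Proof. exact: (linfunE (tlift_linear b)). Qed.

Lemma tlift_tens {k : fieldType} {U V W : vectType k} (b : U -> V -> W) :
  bilin b -> forall u v, tlift b (tens u v) = b u v.
Proof.
move=> [bl br] u v; rewrite /tlift (linfunE (tlift_linear b)).
rewrite [in RHS](coord_vbasis (memvf u)) [in RHS](coord_vbasis (memvf v)).
rewrite (linear_suml _ _ (bl _)); apply: eq_bigr => i _.
rewrite (linear_suml _ _ (br _)) scaler_sumr; apply: eq_bigr => j _.
by rewrite mxE scalerA.
Qed.

Lemma tensor_ext {k : fieldType} {U V W : vectType k}
    (f g : 'Hom(tensor U V, W)) :
  (forall u v, f (tens u v) = g (tens u v)) -> f = g.
Proof.
move=> fg; apply/lfunP => t.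
have -> : t = \sum_i \sum_j (t : 'M[k]_(_, _)) i j *:
    tens (vbasis {:U})`_i (vbasis {:V})`_j.
  have cE (X : vectType k) (i j : 'I_(\dim {:X})) :
      coord (vbasis {:X}) i (vbasis {:X})`_j = (i == j)%:R.
    by rewrite coord_free ?(basis_free (vbasisP _)) // eq_sym.
  apply/matrixP=> i j; rewrite summxE (bigD1 i) //= summxE (bigD1 j) //=.
  rewrite !mxE !cE !eqxx !mulr1.
  rewrite big1 ?addr0 => [|j' nj]; last first.
    by rewrite !mxE !cE [j == _]eq_sym (negPf nj) !mulr0.
  rewrite big1 ?addr0 // => i' ni; rewrite summxE big1 // => j' _.
  by rewrite !mxE !cE [i == _]eq_sym (negPf ni) mul0r mulr0.
rewrite !linear_sum; apply: eq_bigr => i _; rewrite !linear_sum.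
by apply: eq_bigr => j _; rewrite !linearZ /= fg.
Qed.

Definition tmap {k : fieldType} {U V U' V' : vectType k}
    (f : 'Hom(U, U')) (g : 'Hom(V, V')) : 'Hom(tensor U V, tensor U' V') :=
  tlift (fun u v => tens (f u) (g v)).

Lemma tmap_tens {k : fieldType} {U V U' V' : vectType k}
    (f : 'Hom(U, U')) (g : 'Hom(V, V')) u v :
  tmap f g (tens u v) = tens (f u) (g v).
Proof.
have [tl tr] := @tens_bilin k U' V'.
apply: tlift_tens; split=> w a y z; first by rewrite [f _]linearP; apply: tl.
by rewrite [g _]linearP; apply: tr.
Qed.

Definition tassoc {k : fieldType} {U V W : vectType k} :
    'Hom(tensor (tensor U V) W, tensor U (tensor V W)) :=
  tlift (fun t w => tlift (fun u v => tens u (tens v w)) t).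

Lemma tassoc_tens {k : fieldType} {U V W : vectType k} (u : U) (v : V) (w : W) :
  tassoc (tens (tens u v) w) = tens u (tens v w).
Proof.
have [tl1 tr1] := @tens_bilin k U (tensor V W).
have [tl2 tr2] := @tens_bilin k V W.
have bil (w' : W) : bilin (fun (u : U) (v : V) => tens u (tens v w')).
  split=> x a y z; first exact: (tl1 (tens x w')).
  by rewrite -(tr1 x a (tens y w')) -(tl2 w').
rewrite /tassoc tlift_tens ?tlift_tens //; split=> x a y z.
  by rewrite linearP.
suff /lfunP/(_ x) : tlift (fun (u : U) (v : V) => tens u (tens v (a *: y + z))) =
    a *: tlift (fun (u : U) (v : V) => tens u (tens v y)) +
    tlift (fun (u : U) (v : V) => tens u (tens v z)).
  by rewrite add_lfunE scale_lfunE.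
apply: tensor_ext => p q; rewrite add_lfunE scale_lfunE !tlift_tens //.
by rewrite tr2 tr1.
Qed.

(* f (x) g as a functional on U (x) V: u (x) v |-> f(u) g(v).                 *)
Definition tpair {k : fieldType} {U V : vectType k}
    (f : 'Hom(U, k^o)) (g : 'Hom(V, k^o)) : 'Hom(tensor U V, k^o) :=
  tlift (fun u v => (f u * g v : k^o)).

(* The quotient V / R, realised on a complement of R, with its projection.    *)
Definition quotv {k : fieldType} {V : vectType k} (R : {vspace V}) : vectType k :=
  subvs_of (R^C)%VS.

Definition qproj {k : fieldType} {V : vectType k} (R : {vspace V}) :
    'Hom(V, quotv R) :=
  (linfun (@vsproj k V (R^C)%VS) \o daddv_pi (R^C)%VS R)%VF.

(* The map V / R -> W induced by g (meaningful when g vanishes on R).         *)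
Definition qlift {k : fieldType} {V W : vectType k} (R : {vspace V})
    (g : 'Hom(V, W)) : 'Hom(quotv R, W) :=
  (g \o linfun (@vsval k V (R^C)%VS))%VF.

Lemma qprojK {k : fieldType} {V : vectType k} (R : {vspace V}) (v : V) :
  v - vsval (qproj R v : subvs_of _) \in R.
Proof.
have -> : vsval (qproj R v : subvs_of _) = daddv_pi (R^C)%VS R v.
  by rewrite /qproj lfunE /= lfunE /= vsprojK ?memv_pi.
have dis : (R^C :&: R = 0)%VS by rewrite capvC capv_compl.
have vS : (v \in R^C + R)%VS by rewrite addvC addv_complf memvf.
by rewrite -[X in X - _](daddv_pi_add dis vS) addrC addKr memv_pi.
Qed.

Lemma lker_qproj {k : fieldType} {V : vectType k} (R : {vspace V}) :
  lker (qproj R) = R.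
Proof.
apply/vspaceP => v; rewrite memv_ker; apply/eqP/idP => [q0|vR].
  by have := qprojK R v; rewrite q0 /= subr0.
have := qprojK R v; set q := qproj R v => h.
have qR : vsval (q : subvs_of _) \in R by rewrite -[vsval _](subKr v) memvB.
apply/val_inj => /=; apply/eqP; rewrite -memv0 -(capv_compl R) memv_cap qR.
exact: subvsP.
Qed.

Lemma limg_qproj {k : fieldType} {V : vectType k} (R : {vspace V}) :
  limg (qproj R) = fullv.
Proof.
apply/vspaceP => w; rewrite memvf; apply/memv_imgP.
exists (vsval (w : subvs_of _)); rewrite ?memvf // /qproj lfunE /= lfunE /=.
by rewrite daddv_pi_id ?vsvalK ?subvsP // capvC capv_compl.
Qed.

Lemma qlift_proj {k : fieldType} {V W : vectType k} (R : {vspace V})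
    (g : 'Hom(V, W)) :
  (R <= lker g)%VS -> forall v, qlift R g (qproj R v) = g v.
Proof.
move=> sR v; rewrite /qlift lfunE /= lfunE /=.
by apply/eqP; rewrite eq_sym -subr_eq0 -linearB -memv_ker (subvP sR) ?qprojK.
Qed.

(* The tensor product over an algebra C of a right module M and a left module *)
(* N, where x c = r c x and c y = l c y.  By bilinearity it suffices to       *)
(* impose the relations x c (x) y = x (x) c y on bases.                       *)
Definition brel {k : fieldType} {C M N : vectType k}
    (r : C -> 'End(M)) (l : C -> 'End(N)) : {vspace tensor M N} :=
  <<[seq tens (r p.1 p.2.1) p.2.2 - tens p.2.1 (l p.1 p.2.2)
    | p : C * (M * N) <- [seq (c, q) | c <- vbasis {:C},
        q <- [seq (x, y) | x <- vbasis {:M}, y <- vbasis {:N}]]]>>%VS.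

Definition btensor {k : fieldType} {C M N : vectType k}
    (r : C -> 'End(M)) (l : C -> 'End(N)) : vectType k := quotv (brel r l).

Definition btens {k : fieldType} {C M N : vectType k}
    (r : C -> 'End(M)) (l : C -> 'End(N)) (x : M) (y : N) : btensor r l :=
  qproj (brel r l) (tens x y).

(* The linear map on M (x)_C N induced by a C-balanced bilinear map b.        *)
Definition blift {k : fieldType} {C M N W : vectType k}
    (r : C -> 'End(M)) (l : C -> 'End(N)) (b : M -> N -> W) :
    'Hom(btensor r l, W) := qlift (brel r l) (tlift b).

Lemma blift_btens {k : fieldType} {C M N W : vectType k}
    (r : C -> 'End(M)) (l : C -> 'End(N)) (b : M -> N -> W) :
  bilin b -> (forall c x y, b (r c x) y = b x (l c y)) ->
  forall x y, blift r l b (btens r l x y) = b x y.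
Proof.
move=> bb bal x y; rewrite /blift /btens qlift_proj ?tlift_tens //.
apply/span_subvP => _ /mapP[p _ ->]; rewrite memv_ker linearB /=.
by rewrite !tlift_tens // bal subrr.
Qed.

Lemma btens_bilin {k : fieldType} {C M N : vectType k}
    (r : C -> 'End(M)) (l : C -> 'End(N)) : bilin (btens r l).
Proof.
by split=> w a x y; rewrite /btens; case: (@tens_bilin k M N) => tl tr;
  rewrite ?tl ?tr linearP.
Qed.

Lemma btens_balanced {k : fieldType} {C M N : vectType k}
    (r : C -> 'End(M)) (l : C -> 'End(N)) :
  linear r -> linear l ->
  forall c x y, btens r l (r c x) y = btens r l x (l c y).
Proof.
move=> rL lL c x y; have [bl br] := btens_bilin r l.
have fE (X : vectType k) (v : X) := coord_vbasis (memvf v).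
have rl w : linear (r^~ w) by move=> a u v; rewrite rL !lfunE /= lfunE.
have ll w : linear (l^~ w) by move=> a u v; rewrite lL !lfunE /= lfunE.
have gl (X : vectType k) (g h : X -> btensor r l) : linear g -> linear h ->
    (forall i : 'I_(\dim {:X}), g (vbasis {:X})`_i = h (vbasis {:X})`_i) ->
    g =1 h.
  move=> gL hL gh v; rewrite (fE _ v) !linear_suml //.
  by apply: eq_bigr => i _; rewrite gh.
have mB (X : vectType k) (i : 'I_(\dim {:X})) :
    (vbasis {:X})`_i \in (vbasis {:X} : seq X).
  by rewrite mem_nth // size_tuple.
move: c; apply: (gl) => [a u v|a u v|i]; first by rewrite rl bl.
  by rewrite ll br.
move: x; apply: (gl) => [a u v|a u v|j]; first by rewrite linearP bl.
  by rewrite bl.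
move: y; apply: (gl) => [a u v|a u v|h]; first by rewrite br.
  by rewrite linearP br.
apply/eqP; rewrite -subr_eq0 -linearB -memv_ker lker_qproj memv_span //.
set c := (vbasis _)`_i; set x := (vbasis _)`_j; set y := (vbasis _)`_h.
apply/mapP; exists (c, (x, y)) => //.
by apply: allpairs_f; rewrite ?mB //; apply: allpairs_f; rewrite mB.
Qed.

Lemma btensor_ext {k : fieldType} {C M N W : vectType k}
    (r : C -> 'End(M)) (l : C -> 'End(N)) (f g : 'Hom(btensor r l, W)) :
  (forall x y, f (btens r l x y) = g (btens r l x y)) -> f = g.
Proof.
move=> fg; apply/lfunP => t.
have /memv_imgP[s _ ->] : t \in limg (qproj (brel r l)).
  by rewrite limg_qproj memvf.
suff /lfunP/(_ s) : (f \o qproj (brel r l) = g \o qproj (brel r l))%VF.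
  by rewrite !comp_lfunE.
by apply: tensor_ext => x y; rewrite [LHS]comp_lfunE [RHS]comp_lfunE; apply: fg.
Qed.

(* The bimodule D(A): (a f b)(x) = f(b x a).                                  *)
Definition dact {k : fieldType} {A : falgType k} (a : A) (f : 'Hom(A, k^o))
    (b : A) : 'Hom(A, k^o) := (f \o (amull b \o amulr a))%VF.

Lemma dactE {k : fieldType} {A : falgType k} (a b x : A) (f : 'Hom(A, k^o)) :
  dact a f b x = f (b * x * a).
Proof. by rewrite /dact !comp_lfunE !lfunE /= mulrA. Qed.

(* Membership in Hom_A(D(A), A), for left A-modules.                          *)
Definition left_hom {k : fieldType} {A : falgType k}
    (h : 'Hom('Hom(A, k^o), A)) : Prop :=
  forall (a : A) (f : 'Hom(A, k^o)), h (dact a f 1) = a * h f.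

(* Hom_A(D(A), A) is isomorphic to A as a left A-module, where                *)
(* (a h)(f) = h(f a); phi is an isomorphism from A onto Hom_A(D(A), A).       *)
Definition gendo_Frobenius {k : fieldType} (A : falgType k) : Prop :=
  exists phi : 'Hom(A, 'Hom('Hom(A, k^o), A)),
    [/\ injective phi,
        forall h, left_hom h <-> exists x, phi x = h &
        forall (a x : A) (f : 'Hom(A, k^o)), phi (a * x) f = phi x (dact 1 f a)].

Definition eA {k : fieldType} {A : falgType k} (e : A) : {vspace A} :=
  limg (amull e).
Definition Ae {k : fieldType} {A : falgType k} (e : A) : {vspace A} :=
  limg (amulr e).
Definition eAe {k : fieldType} {A : falgType k} (e : A) : {vspace A} :=
  limg (amull e \o amulr e)%VF.

Definition faithful_idem {k : fieldType} {A : falgType k} (e : A) : Prop :=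
  (forall a, (forall y, y \in Ae e -> a * y = 0) -> a = 0) /\
  (forall a, (forall y, y \in eA e -> y * a = 0) -> a = 0).

(* D(eA) and Ae are isomorphic left A-modules, where (a f)(y) = f(y a).       *)
Definition self_dual {k : fieldType} {A : falgType k} (e : A) : Prop :=
  exists phi : 'Hom('Hom(subvs_of (eA e), k^o), subvs_of (Ae e)),
    bijective phi /\
    forall (a : A) (f : 'Hom(subvs_of (eA e), k^o)),
      phi (f \o restr (eA e) (eA e) (amulr a))%VF =
      restr (Ae e) (Ae e) (amull a) (phi f).

(* tau : eA_sigma -> D(Ae) is an isomorphism of (eAe, A)-bimodules:           *)
(* tau (c n sigma(a)) = c (tau n) a, where (c f a)(y) = f(a y c).             *)
Definition bimod_iso {k : fieldType} {A : falgType k} (e : A) (sigma : 'AEnd(A))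
    (tau : 'Hom(subvs_of (eA e), 'Hom(subvs_of (Ae e), k^o))) : Prop :=
  bijective tau /\
  forall (c a : A) (n : subvs_of (eA e)), c \in eAe e ->
    tau (restr (eA e) (eA e) (amull c \o amulr (sigma a))%VF n) =
    (tau n \o restr (Ae e) (Ae e) (amull a \o amulr c))%VF.

(* Ae (x)_{eAe} eA                                                            *)
Definition AeeA {k : fieldType} {A : falgType k} (e : A) : vectType k :=
  btensor (fun c : subvs_of (eAe e) => restr (Ae e) (Ae e) (amulr (vsval c)))
          (fun c : subvs_of (eAe e) => restr (eA e) (eA e) (amull (vsval c))).

Definition AeeA_tens {k : fieldType} {A : falgType k} (e : A)
    (u : subvs_of (Ae e)) (v : subvs_of (eA e)) : AeeA e := btens _ _ u v.

Definition AeeA_lift {k : fieldType} {A : falgType k} (e : A) {W : vectType k}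
    (b : subvs_of (Ae e) -> subvs_of (eA e) -> W) : 'Hom(AeeA e, W) :=
  blift _ _ b.

Section Construction.

Context {k : fieldType} {A : falgType k} (e : A) (sigma : 'AEnd(A)).
Context (tau : 'Hom(subvs_of (eA e), 'Hom(subvs_of (Ae e), k^o))).

(* gamma (u (x) v) (x) = tau (v sigma(x)) (u)                                 *)
Definition gamma : 'Hom(AeeA e, 'Hom(A, k^o)) :=
  AeeA_lift (fun u v => linfun (fun x : A =>
    tau (restr (eA e) (eA e) (amulr (sigma x)) v) u)).

(* (u (x) v) (u' (x) v') |-> (u v u') (x) v'                                  *)
Definition AeeA_mul : 'Hom(tensor (AeeA e) (AeeA e), AeeA e) :=
  tlift (fun s t => AeeA_lift (fun u v => AeeA_lift (fun u' v' =>
    AeeA_tens (restr (Ae e) (Ae e) (amull (vsval u * vsval v)) u') v') t) s).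

(* The map m, i.e. the product AeeA_mul transported along gamma. The partial  *)
(* inverse gamma^-1 is a genuine inverse because gamma is an isomorphism when *)
(* A is gendo-Frobenius, e is faithful and self-dual, and tau is as above.    *)
(* See dmulE and AeeA_mulE.                                                   *)
Definition dmul : 'Hom(tensor 'Hom(A, k^o) 'Hom(A, k^o), 'Hom(A, k^o)) :=
  (gamma \o AeeA_mul \o tmap gamma^-1 gamma^-1)%VF.

(* The k-linear map A -> A (x) A dual to dmul, given by its coordinates; it   *)
(* is characterised by comultE.                                               *)
Definition comult : 'Hom(A, tensor A A) :=
  linfun (fun x : A => (\matrix_(i, j)
    dmul (tens (linfun (coord (vbasis {:A}) j : A -> k^o))
               (linfun (coord (vbasis {:A}) i : A -> k^o))) x) : tensor A A).

Lemma vsval_Ae (u : subvs_of (Ae e)) : e * e = e -> vsval u * e = vsval u.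
Proof.
move=> ee; have /memv_imgP[a _ ->] := subvsP u.
by rewrite lfunE /= -mulrA ee.
Qed.

Lemma vsval_eA (v : subvs_of (eA e)) : e * e = e -> e * vsval v = vsval v.
Proof.
move=> ee; have /memv_imgP[a _ ->] := subvsP v.
by rewrite lfunE /= mulrA ee.
Qed.

Lemma mem_Ae a : e * e = e -> a * e = a -> a \in Ae e.
Proof.
by move=> ee <-; apply/memv_imgP; exists a; rewrite ?memvf // lfunE.
Qed.

Lemma mem_eA a : e * e = e -> e * a = a -> a \in eA e.
Proof.
by move=> ee <-; apply/memv_imgP; exists a; rewrite ?memvf // lfunE.
Qed.

Lemma mem_eAeP c : e * e = e -> c \in eAe e -> e * c = c /\ c * e = c.
Proof.
move=> ee /memv_imgP[a _ ->]; rewrite comp_lfunE !lfunE /=.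
by rewrite -!mulrA ee !mulrA ee.
Qed.

Let gamma_body (u : subvs_of (Ae e)) (v : subvs_of (eA e)) (x : A) : k^o :=
  tau (restr (eA e) (eA e) (amulr (sigma x)) v) u.

Let gamma_body_linear u v : linear (gamma_body u v).
Proof.
move=> a x y; rewrite /gamma_body !restr_proj !linearP.
by rewrite add_lfunE scale_lfunE !linearP add_lfunE scale_lfunE.
Qed.

Lemma gammaE u v x : e * e = e -> bimod_iso sigma tau ->
  gamma (AeeA_tens u v) x = tau (restr (eA e) (eA e) (amulr (sigma x)) v) u.
Proof.
move=> ee [_ tauB]; rewrite /gamma /AeeA_lift /AeeA_tens.
rewrite blift_btens; first exact: (linfunE (gamma_body_linear u v)).
  split=> [v'|u'] a y z; apply/lfunP=> t; rewrite add_lfunE scale_lfunE.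
    rewrite !(linfunE (gamma_body_linear _ _)) /gamma_body.
    by rewrite !linearP.
  rewrite !(linfunE (gamma_body_linear _ _)) /gamma_body.
  by rewrite !linearP add_lfunE scale_lfunE.
move=> c u' v'; apply/lfunP=> t; rewrite !(linfunE (gamma_body_linear _ _)).
rewrite /gamma_body; have [ec ce] := mem_eAeP ee (subvsP c).
have := tauB (vsval c) 1 (restr (eA e) (eA e) (amulr (sigma t)) v') (subvsP c).
have -> : restr (eA e) (eA e) (amull (vsval c) \o amulr (sigma 1))
    (restr (eA e) (eA e) (amulr (sigma t)) v') =
    restr (eA e) (eA e) (amulr (sigma t)) (restr (eA e) (eA e) (amull (vsval c)) v').
  rewrite !restr_proj rmorph1 comp_lfunE !lfunE /= mulr1.
  rewrite !vsprojK ?mulrA // mem_eA // !mulrA ?ec // vsval_eA //.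
move=> ->; rewrite (comp_lfunE _ (restr (Ae e) (Ae e) _)).
suff -> : restr (Ae e) (Ae e) (amull 1 \o amulr (vsval c)) u' =
    restr (Ae e) (Ae e) (amulr (vsval c)) u' by [].
by rewrite !restr_proj comp_lfunE !lfunE /= mul1r.
Qed.

Let prod3 (u : subvs_of (Ae e)) (v : subvs_of (eA e)) (u' : subvs_of (Ae e)) :=
  restr (Ae e) (Ae e) (amull (vsval u * vsval v)) u'.

Let prod3E u v u' : prod3 u v u' = vsproj (Ae e) (vsval u * vsval v * vsval u').
Proof. by rewrite /prod3 restr_proj lfunE. Qed.

Let tensB := btens_bilin
  (fun c : subvs_of (eAe e) => restr (Ae e) (Ae e) (amulr (vsval c)))
  (fun c : subvs_of (eAe e) => restr (eA e) (eA e) (amull (vsval c))).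

Let tensC : forall c u v,
  AeeA_tens (restr (Ae e) (Ae e) (amulr (vsval (c : subvs_of (eAe e)))) u) v =
  AeeA_tens u (restr (eA e) (eA e) (amull (vsval c)) v).
Proof.
by apply: btens_balanced => a c d; apply/lfunP=> w;
  rewrite add_lfunE scale_lfunE !restr_proj !linearP add_lfunE scale_lfunE linearP.
Qed.

Let lift2 u v : 'Hom(AeeA e, AeeA e) :=
  AeeA_lift (fun u' v' => AeeA_tens (prod3 u v u') v').

Let lift2E u v u' v' : e * e = e ->
  lift2 u v (AeeA_tens u' v') = AeeA_tens (prod3 u v u') v'.
Proof.
move=> ee; rewrite /lift2 /AeeA_lift [LHS]blift_btens //.
  split=> w a y z; last exact: tensB.2.
  by rewrite /prod3 linearP; apply: tensB.1.
move=> c x y; rewrite -tensC; congr AeeA_tens.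
rewrite /prod3 !restr_proj; congr vsproj; rewrite !lfunE /= !vsprojK ?mulrA //.
  by apply: mem_Ae => //; rewrite -mulrA vsval_Ae.
by apply: mem_Ae => //; rewrite -mulrA (mem_eAeP ee (subvsP c)).2.
Qed.

Lemma AeeA_mulE (u u' : subvs_of (Ae e)) (v v' : subvs_of (eA e)) : e * e = e ->
  AeeA_mul (tens (AeeA_tens u v) (AeeA_tens u' v')) =
  AeeA_tens (vsproj (Ae e) (vsval u * vsval v * vsval u')) v'.
Proof.
move=> ee; rewrite -prod3E -lift2E //.
have bE t w z : AeeA_lift (fun u v => lift2 u v t) (AeeA_tens w z) = lift2 w z t.
  rewrite /AeeA_lift [LHS]blift_btens //.
    split=> y a p q.
      suff -> : lift2 (a *: p + q) y = a *: lift2 p y + lift2 q y.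
        by rewrite add_lfunE scale_lfunE.
      apply: btensor_ext => x1 x2; rewrite add_lfunE scale_lfunE !lift2E //.
      by rewrite !prod3E !linearP /= !mulrDl -!scalerAl linearP; apply: tensB.1.
    suff -> : lift2 y (a *: p + q) = a *: lift2 y p + lift2 y q.
      by rewrite add_lfunE scale_lfunE.
    apply: btensor_ext => x1 x2; rewrite add_lfunE scale_lfunE !lift2E //.
    rewrite !prod3E !linearP /= mulrDr -!scalerAr mulrDl -!scalerAl linearP.
    exact: tensB.1.
  move=> c x y.
  suff -> : lift2 (restr (Ae e) (Ae e) (amulr (vsval c)) x) y =
    lift2 x (restr (eA e) (eA e) (amull (vsval c)) y) by [].
  apply: btensor_ext => x1 x2; rewrite !lift2E //; congr AeeA_tens.
  have [ec ce] := mem_eAeP ee (subvsP c).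
  rewrite !prod3E !restr_proj !lfunE /= !vsprojK ?mulrA //.
    by apply: mem_eA; rewrite // mulrA ec.
  by apply: mem_Ae; rewrite // -mulrA ce.
rewrite /AeeA_mul tlift_tens ?bE //; split=> w a y z; first by rewrite linearP.
suff /lfunP/(_ w) : AeeA_lift (fun u v => lift2 u v (a *: y + z)) =
    a *: AeeA_lift (fun u v => lift2 u v y) + AeeA_lift (fun u v => lift2 u v z).
  by rewrite add_lfunE scale_lfunE.
apply: btensor_ext => x1 x2; rewrite add_lfunE scale_lfunE.
by rewrite !bE linearP.
Qed.

Lemma dmulE (s t : AeeA e) : injective gamma ->
  dmul (tens (gamma s) (gamma t)) = gamma (AeeA_mul (tens s t)).
Proof.
move=> /lker0P inj; rewrite /dmul 2!comp_lfunE /tmap tlift_tens.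
  by rewrite !lker0_lfunK.
case: (@tens_bilin k (AeeA e) (AeeA e)) => tl tr.
by split=> w a y z; rewrite linearP ?tl ?tr.
Qed.

Lemma comultE (f g : 'Hom(A, k^o)) x :
  tpair f g (comult x) = dmul (tens g f) x.
Proof.
pose cf i : 'Hom(A, k^o) := linfun (coord (vbasis {:A}) i : A -> k^o).
have cfE i y : cf i y = coord (vbasis {:A}) i y by rewrite lfunE.
have fE (h : 'Hom(A, k^o)) : h = \sum_(i < \dim {:A}) (h (vbasis {:A})`_i : k) *: cf i.
  apply/lfunP=> y; rewrite sum_lfunE {1}(coord_vbasis (memvf y)) linear_sum.
  by apply: eq_bigr => i _; rewrite linearZ scale_lfunE cfE; apply: mulrC.
have [tl tr] := @tens_bilin k 'Hom(A, k^o) 'Hom(A, k^o).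
have mE i j : (comult x : 'M[k]_(_, _)) i j = dmul (tens (cf j) (cf i)) x.
  rewrite /comult linfunE ?mxE // => a y z.
  by apply/matrixP=> i' j'; rewrite !mxE linearP.
have gE : tens g f = \sum_(j < \dim {:A}) (g (vbasis {:A})`_j : k) *: tens (cf j) f.
  by rewrite {1}(fE g) (linear_suml _ _ (tl _)).
have fE' j : tens (cf j) f =
    \sum_(i < \dim {:A}) (f (vbasis {:A})`_i : k) *: tens (cf j) (cf i).
  by rewrite {1}(fE f) (linear_suml _ _ (tr _)).
rewrite gE linear_sum sum_lfunE /tpair tliftE exchange_big /=.
apply: eq_bigr => j _; rewrite linearZ scale_lfunE fE' linear_sum sum_lfunE.
rewrite scaler_sumr; apply: eq_bigr => i _.
rewrite [in RHS]linearZ scale_lfunE mE.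
by rewrite /GRing.scale /= mulrC [f _ * _]mulrC -mulrA.
Qed.

End Construction.

Definition coassociative {k : fieldType} {A : falgType k}
    (D : 'Hom(A, tensor A A)) : Prop :=
  forall x, tmap \1 D (D x) = tassoc (tmap D \1 (D x)).

(* The bimodule A (x) A: a (u (x) v) b = a u (x) v b.                         *)
Definition bimod_morphism {k : fieldType} {A : falgType k}
    (D : 'Hom(A, tensor A A)) : Prop :=
  forall a x b, D (a * x * b) = tmap (amull a) (amulr b) (D x).

(* Main.v *)
Require Import Defs.
From HB Require Import structures.
From mathcomp Require Import all_boot all_algebra all_field.

Import GRing.Theory.
Local Open Scope ring_scope.

(** The multiplication map [mu : Ae (x) eA -> A] satisfies
    [s * t = mu(s) t = s mu(t)] for the product on [Ae (x)_{eAe} eA], and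
    [gamma] turns the left action of [a] and the right action of [sigma b] into the
    actions of [a] and [b] on [D(A)].  Hence the kernel of [gamma] absorbs
    products on both sides, and [gamma] is onto because [eA] is faithful and
    [tau] is injective; so [m] is determined by
    [m(gamma s (x) gamma t) = gamma(s * t)] even without the injectivity of
    [gamma].  Associativity and bilinearity of [m] can then be read off from
    pure tensors, and they dualise to the two claims on [Delta]. *)

(** * Functionals on a space and on a tensor product *)

Lemma functional_sep {k : fieldType} {U : vectType k} (u v : U) :
  (forall f : 'Hom(U, k^o), f u = f v) -> u = v.
Proof.
move=> fuv; rewrite (coord_vbasis (memvf u)) (coord_vbasis (memvf v)).
apply: eq_bigr => i _; congr (_ *: _).
by have := fuv (linfun (coord (vbasis {:U}) i : U -> k^o)); rewrite !lfunE.
Qed.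

(** By dimension count: evaluation embeds [U] into the dual of [F], so [F] has at least the
    dimension of the whole dual. *)
Lemma functionals_full {k : fieldType} {U : vectType k}
    (F : {vspace 'Hom(U, k^o)}) :
  (forall x, (forall f, f \in F -> f x = 0) -> x = 0) -> F = fullv.
Proof.
move=> sepF.
pose ev : U -> 'Hom(subvs_of F, k^o) :=
  fun x => linfun (fun f : subvs_of F => vsval f x : k^o).
have evL x : linear (fun f : subvs_of F => vsval f x : k^o).
  by move=> a f g; rewrite linearP add_lfunE scale_lfunE.
have ev_linear : linear ev.
  move=> a x y; apply/lfunP=> f.
  by rewrite add_lfunE scale_lfunE !(linfunE (evL _)) linearP.
have ev0 : lker (linfun ev) == 0%VS.
  rewrite -subv0; apply/subvP=> x; rewrite memv_ker memv0 (linfunE ev_linear).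
  move=> /eqP/lfunP ex; apply/eqP/sepF => f fF.
  by have := ex (vsproj F f); rewrite (linfunE (evL _)) vsprojK // zero_lfunE.
apply/eqP; rewrite eqEdim subvf dimvf /=.
have := limg_dim_eq (f := linfun ev) (U := fullv).
rewrite (eqP ev0) capv0 => /(_ erefl) dE.
have := dimvS (subvf (limg (linfun ev))); rewrite dE !dimvf.
have hd (X : vectType k) : dim 'Hom(X, k^o) = dim X by apply: muln1.
by rewrite !hd.
Qed.

Lemma tpair_tens {k : fieldType} {U V : vectType k}
    (f : 'Hom(U, k^o)) (g : 'Hom(V, k^o)) u v :
  tpair f g (tens u v) = f u * g v.
Proof.
apply: tlift_tens; split=> w a x y; rewrite linearP /=.
  by rewrite mulrDl -mulrA.
by rewrite mulrDr mulrCA.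
Qed.

(** Contraction of the first factor, so that threefold tensors can be tested one factor at a
    time. *)
Definition contr {k : fieldType} {U V : vectType k} (f : 'Hom(U, k^o)) :
    'Hom(tensor U V, V) :=
  tlift (fun u v => (f u : k) *: v).

Lemma contr_tens {k : fieldType} {U V : vectType k} (f : 'Hom(U, k^o))
    u (v : V) :
  contr f (tens u v) = (f u : k) *: v.
Proof.
apply: tlift_tens; split=> w a x y; rewrite ?linearP //=.
by rewrite scalerDl scalerA.
Qed.

Lemma contr_sep {k : fieldType} {U V : vectType k} (s t : tensor U V) :
  (forall f : 'Hom(U, k^o), contr f s = contr f t) -> s = t.
Proof.
move=> fst; apply/matrixP=> i j.
pose f : 'Hom(U, k^o) := linfun (coord (vbasis {:U}) i : U -> k^o).
(* Contracting with the [i]-th coordinate functional reads off row [i] of the coordinate matrix. *)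
have cE (r : tensor U V) :
    contr f r = \sum_j (r : 'M[k]_(_, _)) i j *: (vbasis {:V})`_j.
  rewrite /contr tliftE (bigD1 i) //= [X in _ + X]big1 ?addr0 => [|i' ni].
    apply: eq_bigr => j' _.
    by rewrite lfunE /= coord_free ?(basis_free (vbasisP _)) // eqxx scale1r.
  apply: big1 => j' _; rewrite lfunE /= coord_free ?(basis_free (vbasisP _)) //.
  by rewrite (negPf ni) scale0r scaler0.
have := congr1 (coord (vbasis {:V}) j) (fst f).
by rewrite !cE !coord_sum_free ?(basis_free (vbasisP _)).
Qed.

Lemma functional_contr {k : fieldType} {U V : vectType k}
    (f : 'Hom(U, k^o)) (g : 'Hom(V, k^o)) (t : tensor U V) :
  g (contr f t) = tpair f g t.
Proof.
suff /lfunP/(_ t) : (g \o contr f = tpair f g)%VF by rewrite comp_lfunE.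
by apply: tensor_ext => u v; rewrite comp_lfunE contr_tens tpair_tens linearZ.
Qed.

Lemma tpair_sep {k : fieldType} {U V : vectType k} (s t : tensor U V) :
  (forall (f : 'Hom(U, k^o)) (g : 'Hom(V, k^o)), tpair f g s = tpair f g t) ->
  s = t.
Proof.
move=> fgst; apply: contr_sep => f; apply: functional_sep => g.
by rewrite !functional_contr.
Qed.

(** * Passing from a product on D(A) to its dual coproduct on A *)

Section DualCoalgebra.

Context {k : fieldType} {A : falgType k}.
Context {D : 'Hom(A, tensor A A)}.
Context {m : 'Hom(tensor 'Hom(A, k^o) 'Hom(A, k^o), 'Hom(A, k^o))}.
Hypothesis DE : forall f g x, tpair f g (D x) = m (tens g f) x.

(** Testing against [f], [g], [h] and using the reversed order in [DE], the two sides become the two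
    bracketings of the product of [h], [g], [f]. *)
Lemma coassociative_dual :
  (forall f g h, m (tens (m (tens f g)) h) = m (tens f (m (tens g h)))) ->
  coassociative D.
Proof.
move=> mA x; apply: contr_sep => f; apply: contr_sep => g.
apply: functional_sep => h; rewrite !functional_contr.
transitivity (m (tens (m (tens h g)) f) x).
  rewrite -DE; set t := D x.
  suff /lfunP/(_ t) : (tpair f (tpair g h) \o tmap \1 D =
      tpair f (m (tens h g)))%VF by rewrite comp_lfunE.
  apply: tensor_ext => u v; rewrite comp_lfunE tmap_tens !tpair_tens.
  by rewrite DE id_lfunE.
rewrite mA -DE; set t := D x.
suff /lfunP/(_ t) : (tpair f (tpair g h) \o tassoc \o tmap D \1 =
    tpair (m (tens g f)) h)%VF by rewrite !comp_lfunE.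
apply: tensor_ext => u v; rewrite !comp_lfunE tmap_tens tpair_tens id_lfunE -DE.
have tL : linear (fun s : tensor A A => tens s v).
  by move=> a y z; apply: (@tens_bilin k (tensor A A) A).1.
have hL : linear (fun s : k^o => (s * h v : k^o)).
  by move=> a y z; rewrite mulrDl -scalerAl.
(* For fixed [v] both sides are linear in [D u], which may thus be replaced by a pure tensor. *)
suff /lfunP/(_ (D u)) : (tpair f (tpair g h) \o tassoc \o linfun (tens^~ v) =
    linfun (fun s : k^o => (s * h v : k^o)) \o tpair f g)%VF.
  by rewrite !comp_lfunE (linfunE tL) (linfunE hL).
apply: tensor_ext => y z; rewrite !comp_lfunE (linfunE tL) (linfunE hL).
by rewrite tassoc_tens !tpair_tens mulrA.
Qed.

(** Evaluating at [a * x * b] amounts to letting [b] act on the left and [a] on the right of the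
    functional; the swap in [DE] then puts [a] on the first leg and [b] on the second. *)
Lemma bimod_morphism_dual :
  (forall a f g b, m (tens (dact a f 1) (dact 1 g b)) =
    dact a (m (tens f g)) b) ->
  bimod_morphism D.
Proof.
move=> mB a x b; apply: tpair_sep => f g.
rewrite DE -dactE -mB -DE; set t := D x.
suff /lfunP/(_ t) : (tpair (dact 1 f a) (dact b g 1) =
    tpair f g \o tmap (amull a) (amulr b))%VF by rewrite comp_lfunE.
apply: tensor_ext => u v.
by rewrite comp_lfunE tmap_tens !tpair_tens !dactE !lfunE /= mulr1 mul1r.
Qed.

End DualCoalgebra.

(** * The bimodule D(A) and the map [gamma] *)

Lemma dact_linear {k : fieldType} {A : falgType k} (a b : A) :
  linear (fun f : 'Hom(A, k^o) => dact a f b).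
Proof.
move=> c f g; apply/lfunP=> x.
by rewrite add_lfunE scale_lfunE !dactE add_lfunE scale_lfunE.
Qed.

Section Gamma.

Context {k : fieldType} {A : falgType k} {e : A} {sigma : 'AEnd(A)}.
Context {tau : 'Hom(subvs_of (eA e), 'Hom(subvs_of (Ae e), k^o))}.
Hypotheses (ee : e * e = e) (tauP : bimod_iso sigma tau).

Local Notation gamma := (gamma sigma tau).
Local Notation AeeA_mul := (AeeA_mul e).
Local Notation dmul := (dmul sigma tau).
Local Notation projAe := (vsproj (Ae e)).
Local Notation projeA := (vsproj (eA e)).

Lemma projAeK a : a * e = a -> vsval (projAe a) = a.
Proof. by move=> ae; rewrite vsprojK // mem_Ae. Qed.

Lemma projeAK a : e * a = a -> vsval (projeA a) = a.
Proof. by move=> ea; rewrite vsprojK // mem_eA. Qed.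

Lemma gamma_tensE u v x :
  gamma (AeeA_tens u v) x = tau (projeA (vsval v * sigma x)) u.
Proof. by rewrite gammaE // restr_proj lfunE. Qed.

Lemma tau_bimod c n a y : c \in eAe e ->
  tau (projeA (c * vsval n * sigma a)) y = tau n (projAe (a * vsval y * c)).
Proof.
move=> ce; have := congr1 (fun f : 'Hom(_, k^o) => f y) (tauP.2 c a n ce).
by rewrite (comp_lfunE (tau n)) !restr_proj !comp_lfunE !lfunE /= !mulrA.
Qed.

Lemma dact_gamma a u v b :
  dact a (gamma (AeeA_tens u v)) b =
  gamma (AeeA_tens (projAe (a * vsval u)) (projeA (vsval v * sigma b))).
Proof.
apply/lfunP=> x; rewrite dactE !gamma_tensE.
have ve w : e * (vsval v * w) = vsval v * w by rewrite mulrA vsval_eA.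
(* Taking [c = e], the unit of eAe, in [tau_bimod] isolates the action of A. *)
have eP : e \in eAe e.
  by apply/memv_imgP; exists e; rewrite ?memvf // comp_lfunE !lfunE /= ee.
rewrite projeAK //.
have := tau_bimod e (projeA (vsval v * sigma b * sigma x)) a u eP.
rewrite projeAK -?mulrA // (vsval_Ae _ ee) => <-.
by rewrite !rmorphM !mulrA vsval_eA.
Qed.

Lemma AeeA_ext {W : vectType k} (f g : AeeA e -> W) :
  linear f -> linear g ->
  (forall u v, f (AeeA_tens u v) = g (AeeA_tens u v)) -> f =1 g.
Proof.
move=> fL gL fg t; rewrite -(linfunE fL) -(linfunE gL).
suff -> : linfun f = linfun g by [].
by apply: btensor_ext => u v; rewrite (linfunE fL) (linfunE gL) fg.
Qed.

Lemma gamma_mul_linearl t : linear (fun s => gamma (AeeA_mul (tens s t))).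
Proof. by move=> c x y; rewrite (tens_bilin.1 t) !linearP. Qed.

Lemma gamma_mul_linearr s : linear (fun t => gamma (AeeA_mul (tens s t))).
Proof. by move=> c x y; rewrite (tens_bilin.2 s) !linearP. Qed.

Lemma dact_gamma_linear a b : linear (fun s => dact a (gamma s) b).
Proof. by move=> c x y; rewrite linearP dact_linear. Qed.

Lemma gamma_mul_tensl u v t :
  gamma (AeeA_mul (tens (AeeA_tens u v) t)) =
  dact (vsval u * vsval v) (gamma t) 1.
Proof.
move: t; apply: AeeA_ext => [||u' v']; first exact: gamma_mul_linearr.
  exact: dact_gamma_linear.
by rewrite AeeA_mulE // dact_gamma rmorph1 mulr1 vsvalK.
Qed.

Lemma gamma_mul_tensr u v b s : sigma b = vsval u * vsval v ->
  gamma (AeeA_mul (tens s (AeeA_tens u v))) = dact 1 (gamma s) b.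
Proof.
move=> bE; move: s; apply: AeeA_ext => [||u' v'].
- exact: gamma_mul_linearl.
- exact: dact_gamma_linear.
rewrite AeeA_mulE //; apply/lfunP=> x; rewrite dactE !gamma_tensE mulr1.
have -> : sigma (b * x) = vsval u * vsval v * sigma x by rewrite -bE -rmorphM.
(* Since v'u lies in eAe, [tau] moves it across: tau(v sigma(x))(u'v'u) = tau(v'uv sigma(x))(u'). *)
have vuP : vsval v' * vsval u \in eAe e.
  apply/memv_imgP; exists (vsval v' * vsval u); rewrite ?memvf //.
  by rewrite comp_lfunE !lfunE /= -mulrA vsval_Ae // mulrA vsval_eA.
have := tau_bimod _ (projeA (vsval v * sigma x)) 1 u' vuP.
by rewrite projeAK ?mulrA ?vsval_eA // rmorph1 mulr1 mul1r => ->.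
Qed.

(** If all functionals in the image vanish at [x], then tau(y sigma(x)) = 0 for every [y] in eA, so
    y sigma(x) = 0, hence sigma(x) = 0 and x = 0. An image without common zeros is the whole
    dual. *)
Lemma limg_gamma : faithful_idem e -> injective sigma -> limg gamma = fullv.
Proof.
move=> [_ eA_faith] sigma_inj; apply: functionals_full => x gx0.
apply: sigma_inj; rewrite rmorph0; apply: eA_faith => y yP.
have [tau' tauK _] := tauP.1.
have eyx : e * (y * sigma x) = y * sigma x.
  by have := vsval_eA (projeA y) ee; rewrite vsprojK // mulrA => ->.
rewrite -(projeAK _ eyx); suff -> : projeA (y * sigma x) = 0 by rewrite linear0.
apply: (can_inj tauK); rewrite linear0; apply/lfunP=> u; rewrite zero_lfunE.
have := gx0 (gamma (AeeA_tens u (projeA y))) (memv_img _ (memvf _)).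
by rewrite gamma_tensE vsprojK.
Qed.

(** * The product on D(A), computed on images of pure tensors *)

Hypotheses (gamma_surj : limg gamma = fullv) (sigma_bij : bijective sigma).

Lemma gammaVK f : gamma (gamma^-1%VF f) = f.
Proof. by rewrite limg_lfunVK // gamma_surj memvf. Qed.

Lemma gamma_ext {W : vectType k} (f g : 'Hom(A, k^o) -> W) :
  linear f -> linear g ->
  (forall u v, f (gamma (AeeA_tens u v)) = g (gamma (AeeA_tens u v))) -> f =1 g.
Proof.
move=> fL gL fg x; rewrite -(gammaVK x); move: (_ x); apply: AeeA_ext => //.
  by move=> a y z; rewrite linearP fL.
by move=> a y z; rewrite linearP gL.
Qed.

(* Valid even if [gamma] is not injective: by the previous formulas its kernel
   absorbs products on either side, so the choice made by [gamma^-1] is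
   irrelevant. *)
Lemma dmul_gamma s t :
  dmul (tens (gamma s) (gamma t)) = gamma (AeeA_mul (tens s t)).
Proof.
have [sigma' _ sigmaK] := sigma_bij.
have mul_indepl s1 s2 : gamma s1 = gamma s2 ->
    forall t0, gamma (AeeA_mul (tens s1 t0)) = gamma (AeeA_mul (tens s2 t0)).
  move=> g12; apply: AeeA_ext => [||u v]; try exact: gamma_mul_linearr.
  (* Surjectivity of [sigma] supplies a preimage of uv, which then acts on the right of D(A). *)
  by rewrite !(gamma_mul_tensr _ _ _ _ (sigmaK _)) g12.
have mul_indepr t1 t2 : gamma t1 = gamma t2 ->
    forall s0, gamma (AeeA_mul (tens s0 t1)) = gamma (AeeA_mul (tens s0 t2)).
  move=> g12; apply: AeeA_ext => [||u v]; try exact: gamma_mul_linearl.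
  by rewrite !gamma_mul_tensl g12.
rewrite /dmul 2!comp_lfunE tmap_tens (mul_indepl _ s) ?gammaVK //.
by rewrite (mul_indepr _ t) ?gammaVK.
Qed.

Lemma dmul_gamma_tens u v u' v' :
  dmul (tens (gamma (AeeA_tens u v)) (gamma (AeeA_tens u' v'))) =
  gamma (AeeA_tens (projAe (vsval u * vsval v * vsval u')) v').
Proof. by rewrite dmul_gamma AeeA_mulE. Qed.

Lemma dmulA f g h :
  dmul (tens (dmul (tens f g)) h) = dmul (tens f (dmul (tens g h))).
Proof.
have [tl tr] := @tens_bilin k 'Hom(A, k^o) 'Hom(A, k^o).
move: f; apply: gamma_ext => [a x y|a x y|u v].
- by rewrite tl linearP tl linearP.
- by rewrite tl linearP.
move: g; apply: gamma_ext => [a x y|a x y|u' v'].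
- by rewrite tr linearP tl linearP.
- by rewrite tl linearP tr linearP.
move: h; apply: gamma_ext => [a x y|a x y|u'' v''].
- by rewrite tr linearP.
- by rewrite tr linearP tr linearP.
(* Both bracketings are the image of uvu'v'u'' tensor v''. *)
rewrite !dmul_gamma_tens; congr (gamma (AeeA_tens (projAe _) _)).
by rewrite !projAeK ?mulrA // -mulrA vsval_Ae.
Qed.

Lemma dmul_dact a f g b :
  dmul (tens (dact a f 1) (dact 1 g b)) = dact a (dmul (tens f g)) b.
Proof.
have [tl tr] := @tens_bilin k 'Hom(A, k^o) 'Hom(A, k^o).
move: f; apply: gamma_ext => [c x y|c x y|u v].
- by rewrite dact_linear tl linearP.
- by rewrite tl linearP dact_linear.
move: g; apply: gamma_ext => [c x y|c x y|u' v'].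
- by rewrite dact_linear tr linearP.
- by rewrite tr linearP dact_linear.
(* Both sides are the image of auvu' tensor v' sigma(b). *)
rewrite !dact_gamma !dmul_gamma_tens dact_gamma rmorph1 !mul1r !mulr1 !vsvalK.
congr (gamma (AeeA_tens (projAe _) _)).
by rewrite !projAeK ?mulrA // -!mulrA vsval_Ae.
Qed.

End Gamma.

Theorem theorem4p3 (k : fieldType) (A : falgType k) (hA : gendo_Frobenius A)
    (e : A) (he : e * e = e) (hfaith : faithful_idem e)
    (hdual : self_dual e)
    (sigma : 'AEnd(A)) (hsigma : bijective sigma)
    (tau : 'Hom(subvs_of (eA e), 'Hom(subvs_of (Ae e), k^o)))
    (htau : bimod_iso sigma tau) :
  coassociative (comult sigma tau) /\ bimod_morphism (comult sigma tau).
Proof.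
have gamma_surj := limg_gamma he htau hfaith (bij_inj hsigma).
have DE f g x := comultE sigma tau f g x.
split; first by apply: (coassociative_dual DE) => f g h; apply: dmulA.
by apply: (bimod_morphism_dual DE) => a f g b; apply: dmul_dact.
Qed.
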